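(* For every integer $n\ge1$, the Narayana polynomials satisfy \[C_n(q)=(1-q)^{n-1}+q\sum_{k=1}^{n-1}C_{n-k}(q)\sum_{m=0}^{k-1}(-1)^m\binom{k-1}{m}\binom{n-m}{k}(1-q)^{k-m-1}.\]
   Context: $q$ is an indeterminate. The Narayana polynomials are $C_0(q)=1$ and $C_n(q)=\sum_{k=1}^n \frac1n\binom{n}{k-1}\binom{n}{k}q^{k-1}$ for $n\ge1$. *)

(* Defs.v *)
From mathcomp Require Import all_boot all_order all_algebra.

Set Implicit Arguments.
Unset Strict Implicit.
Unset Printing Implicit Defensive.

Import GRing.Theory.
Local Open Scope ring_scope.

(* Coefficients are taken in rat so that the factor 1/n is a genuine division;
   the indeterminate q is 'X. *)
Definition narayana (n : nat) : {poly rat} :=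
  if n == 0%N then 1
  else \sum_(1 <= k < n.+1)
         (n%:R^-1 * 'C(n, k - 1)%:R * 'C(n, k)%:R) *: 'X^(k - 1).

(* Main.v *)
Require Import Defs.
From mathcomp Require Import all_boot all_order all_algebra.
From mathcomp Require Import ring zify.

Set Implicit Arguments.
Unset Strict Implicit.
Unset Printing Implicit Defensive.

Import GRing.Theory.
Local Open Scope ring_scope.

(* With phi(w) = (1 + w)(1 + q w), the definition of C_N reads
   C_N = [w^(N-1)] phi^N / N, so Lagrange inversion gives
   \sum_N C_N (w / phi)^N = w.  Multiply by (1 + w)^(n-1) / (1 + q w) and
   extract [w^n].  The right-hand side is [w^(n-1)] (1 + w)^(n-1) / (1 + q w),
   that is (1 - q)^(n-1).  On the left, N = n contributes C_n, and N = n - k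
   with 0 < k contributes C_(n-k) [w^k] (1 + w)^(k-1) / (1 + q w)^(n-k+1).
   Expanding q (1 + w) = (1 + q w) - (1 - q) turns that coefficient into -q
   times the inner sum.

   A power series inverse psi of phi is encoded by a polynomial such that
   phi * psi = 1 + 'X^K * r: it is only used on coefficients of index < K. *)

Lemma coefM_1DXn_exp (R : comNzRingType) (K m i : nat) (p r : {poly R}) :
  (i < K)%N -> (p * (1 + 'X^K * r) ^+ m)`_i = p`_i.
Proof.
move=> ltiK; elim: m => [|m IHm]; first by rewrite expr0 mulr1.
rewrite exprS mulrCA mulrDl mul1r coefD -mulrA coefXnM ltiK addr0.
exact: IHm.
Qed.

Lemma coef_expM_exp (R : comNzRingType) (K a b i : nat) (f phi psi r : {poly R}) :
  phi * psi = 1 + 'X^K * r -> (b <= a)%N -> (i < K)%N ->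
  (f * (phi ^+ a * psi ^+ b))`_i = (f * phi ^+ (a - b))`_i.
Proof.
move=> inv leba ltiK.
rewrite -{1}(subnK leba) exprD -mulrA -exprMn inv mulrA.
exact: coefM_1DXn_exp.
Qed.

Lemma coef_expM_exp_ge (R : comNzRingType) (K a b i : nat)
    (f phi psi r : {poly R}) :
  phi * psi = 1 + 'X^K * r -> (a <= b)%N -> (i < K)%N ->
  (f * (phi ^+ a * psi ^+ b))`_i = (f * psi ^+ (b - a))`_i.
Proof.
by move=> inv leab ltiK; rewrite [phi ^+ a * _]mulrC;
  apply: coef_expM_exp leab ltiK; rewrite mulrC; apply: inv.
Qed.

Section Lagrange.

Variable (R : comUnitRingType).
Hypothesis natr_unit : forall n, n.+1%:R \is a @GRing.unit R.

Lemma coef_exp_deriv (phi : {poly R}) (d : nat) :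
  (phi ^+ d * phi^`())`_d = (phi ^+ d.+1)`_d.+1.
Proof.
apply: (mulrI (natr_unit d)).
rewrite mulr_natl -coefMn mulrC -mulrnAl -mulr_natl mulr_natl.
rewrite [RHS]mulr_natl -coef_deriv deriv_exp /= mulrC.
by rewrite !mulrnAr mulrC.
Qed.

Lemma coefX_deriv (p : {poly R}) (i : nat) : ('X * p^`())`_i = p`_i *+ i.
Proof. by rewrite coefXM; case: i => [|i] //=; rewrite coef_deriv. Qed.

(* For M > n this is the vanishing of
   [w^d] phi^d - [w^(d-1)] phi^(d-1) phi' at d = M - n. *)
Lemma coef_Lagrange_deriv (K M n : nat) (phi psi r : {poly R}) :
  phi * psi = 1 + 'X^K * r -> (M < K)%N ->
  (phi ^+ M * ('X * (('X * psi) ^+ n)^`()))`_M = ((M == n) * M)%:R.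
Proof.
move=> inv; case: M => [|m] ltMK; first by rewrite mulrCA coefXM muln0.
have split_deriv (p g : {poly R}) :
    p * ('X * g^`()) = 'X * (p * g)^`() - 'X * (p^`() * g).
  by rewrite derivM mulrDr addrAC subrr add0r mulrCA.
(* Both terms carry a factor [M]: one from the index, one from the derivative of [phi ^+ M]. *)
rewrite split_deriv coefB coefX_deriv deriv_exp /= mulrnAl mulrnAr coefMn.
rewrite -mulrnBl exprMn natrM mulr_natr; congr (_ *+ _).
rewrite mulrCA coefXnM coefXM /= -mulrA [phi ^+ m * _]mulrCA.
rewrite [_ * ('X^n * _)]mulrCA coefXnM.
case: (ltngtP m.+1 n) => [ltmn|ltnm|<-] /=.
- by rewrite subrr.
- have leb_lt a b : (a < K -> a - b < K)%N by apply: leq_ltn_trans (leq_subr _ _).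
  rewrite -[phi ^+ m.+1 * _]mul1r.
  rewrite (coef_expM_exp _ inv) ?(ltnW ltnm) ?leb_lt // mul1r.
  rewrite (coef_expM_exp _ inv) ?leb_lt ?(ltnSE ltnm) ?(ltnW ltMK) //.
  by rewrite subSn // [_ * phi ^+ _]mulrC coef_exp_deriv subrr.
- rewrite subr0 subnn -[phi ^+ _ * _]mul1r.
  rewrite (coef_expM_exp _ inv) ?(leq_ltn_trans _ ltMK) //.
  by rewrite subnn mulr1 coef1.
Qed.

(* The orthogonality relation coef_Lagrange_deriv says B *m A = 1 for two square
   matrices; the inversion formula is the first column of A *m B = 1. *)
Lemma Lagrange_inversion (n : nat) (phi psi r : {poly R}) (i : nat) :
  phi * psi = 1 + 'X^(n.+1) * r -> (i <= n)%N ->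
  (\sum_(1 <= k < n.+1) ((phi ^+ k)`_k.-1 / k%:R) *: ('X * psi) ^+ k)`_i
  = 'X`_i.
Proof.
move=> inv lein.
pose A : 'M[R]_n := \matrix_(a, b) (('X * psi) ^+ b.+1)`_a.+1.
(* The shift by ['X^(b.+1)] makes the entries with [b > a] zero, where a truncated index [a - b]
   would give the constant coefficient. The factor [b.+1] reproduces ['X] times a derivative in the
   product. *)
pose B : 'M[R]_n :=
  \matrix_(a, b) (('X^(b.+1) * phi ^+ a.+1)`_a.+1 *+ b.+1 / a.+1%:R).
have BA : B *m A = 1%:M.
  apply/matrixP=> a b; rewrite !mxE.
  have ltaK : (a.+1 < n.+1)%N by rewrite ltnS.
  apply: (mulIr (natr_unit a)).
  rewrite mulr_suml mulr_natr -mulrnA.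
  have := coef_Lagrange_deriv b.+1 inv ltaK.
  rewrite coefMr big_ord_recl /= coefXM eqxx mulr0 add0r => <-.
  rewrite (big_ord_widen n (fun j : nat => (phi ^+ a.+1)`_(a.+1 - j.+1) *
    ('X * (('X * psi) ^+ b.+1)^`())`_j.+1)) // [RHS]big_mkcond /=.
  apply: eq_bigr => j _; rewrite !mxE coefXnM coefX_deriv !ltnS.
  rewrite [(j <= a)%N]leqNgt; case: ltnP => _ /=; first by rewrite mul0rn !mul0r.
  by rewrite mulrAC divrK // mulrnAl mulrnAr.
rewrite coef_sum coefX; case: i lein => [_|i ltin].
  rewrite big_nat big1 // => k /andP[k_gt0 _].
  by rewrite coefZ exprMn coefXnM k_gt0 mulr0.
have AB := mulmx1C BA.
move/matrixP/(_ (Ordinal ltin) (Ordinal (leq_ltn_trans (leq0n i) ltin))): AB.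
rewrite !mxE -val_eqE /= => <-.
rewrite big_add1 /= big_mkord; apply: eq_bigr => j _.
by rewrite !mxE /= coefZ coefXM mulrC mulr1n.
Qed.

End Lagrange.

(** Multiplying by [1 + c *: 'X] lowers the power of [E] by one below index [K]; up to powers of
    [- c], the resulting recurrence is Pascal's rule. *)
Lemma coef_geometric_exp (R : comNzRingType) (K m i : nat) (c : R)
    (E r : {poly R}) :
  (1 + c *: 'X) * E = 1 + 'X^K * r -> (i < K)%N ->
  (E ^+ m.+1)`_i = (- c) ^+ i * 'C(m + i, i)%:R.
Proof.
move=> inv.
have rec k j : (j < K)%N ->
    (E ^+ k.+1)`_j = (E ^+ k)`_j - c * (if j is j'.+1 then (E ^+ k.+1)`_j' else 0).
  move=> ltjK; rewrite -(coefM_1DXn_exp 1 (E ^+ k) r ltjK) expr1 -inv.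
  rewrite mulrCA -exprSr mulrDl mul1r coefD -scalerAl coefZ coefXM.
  by case: j {ltjK} => [|j]; rewrite /= addrK.
elim: m i => [|m IHm]; elim=> [|i IHi] ltiK; rewrite rec //.
- by rewrite mulr0 subr0 coef1 expr0 mul1r.
- by rewrite IHi 1?ltnW // coef1 !add0n !binn !mulr1 sub0r exprS mulNr.
- by rewrite IHm // mulr0 subr0 !addn0 !bin0.
- rewrite IHm // IHi 1?ltnW // [(m.+1 + i.+1)%N]addSn binS [(m.+1 + i)%N]addSnnS.
  by rewrite natrD mulrDr exprS !mulNr !mulrA.
Qed.

Lemma geometric_inverse (R : comNzRingType) (K : nat) (c : R) :
  exists E r : {poly R}, (1 + c *: 'X) * E = 1 + 'X^K * r.
Proof.
exists (\sum_(i < K) (- c *: 'X) ^+ i), (- ((- c) ^+ K)%:P).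
rewrite -[LHS]opprK -mulNr opprD addrC -scaleNr -subrX1 opprB exprZn.
by rewrite mulrN mulrC mul_polyC.
Qed.

Lemma coef_exp_1DZX (R : comNzRingType) (c : R) (n i : nat) :
  ((1 + c *: 'X) ^+ n)`_i = c ^+ i * 'C(n, i)%:R.
Proof.
rewrite exprDn coef_sum.
under eq_bigr => j _ do
  rewrite expr1n mul1r exprZn coefMn coefZ coefXn -mulrnAr -mulrnA.
have [ltni|lein] := ltnP n i.
  rewrite bin_small // mulr0 big1 // => j _.
  by rewrite gtn_eqF ?mulr0 // (leq_trans _ ltni).
rewrite (bigD1 (Ordinal (lein : (i < n.+1)%N))) //= eqxx mul1n big1 ?addr0 //.
by move=> j; rewrite -val_eqE /= eq_sym => /negPf ->; rewrite mulr0.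
Qed.

Lemma coef_exp_1DX (R : comNzRingType) (n i : nat) :
  ((1 + 'X : {poly R}) ^+ n)`_i = 'C(n, i)%:R.
Proof. by rewrite -['X]scale1r coef_exp_1DZX expr1n mul1r. Qed.

Lemma coef_exp_geometric (R : idomainType) (q : R) (K N k : nat)
    (E r : {poly R}) :
  q != 0 -> (1 + q *: 'X) * E = 1 + 'X^K * r -> (0 < k < K)%N ->
  ((1 + 'X) ^+ k.-1 * E ^+ N.+1)`_k =
  - q * \sum_(0 <= m < k)
     ((-1) ^+ m * 'C(k - 1, m)%:R * 'C(N + k - m, k)%:R
      * (1 - q) ^+ (k - m - 1)).
Proof.
move=> q0 inv; case: k => // k /= ltkK.
(* The factor [q ^+ k] turns [(1 + 'X) ^+ k] into a binomial in [q - 1] and [1 + q *: 'X], whose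
   powers cancel against [E]. *)
apply: (mulfI (expf_neq0 k q0)).
rewrite -coefZ scalerAl -exprZn.
have -> : q *: (1 + 'X) = (q - 1)%:P + (1 + q *: 'X) :> {poly R}.
  by rewrite scalerDr polyCB polyC1 addrA subrK -mul_polyC mulr1.
rewrite exprDn mulr_suml coef_sum mulrA mulr_sumr big_mkord.
apply: eq_bigr => m _; have lemk : (m <= k)%N by rewrite -ltnS.
rewrite subn1 /= mulrnAl coefMn -[in LHS]mulrA -polyC_exp coefCM.
have -> : ((1 + q *: 'X) ^+ m * E ^+ N.+1)`_k.+1
    = (- q) ^+ k.+1 * 'C(N + k.+1 - m, k.+1)%:R.
  (* For [m > N] a polynomial of degree below [k.+1] remains, and the binomial on the right vanishes
     too. *)
  rewrite -[_ * _]mul1r; have [lemN|ltNm] := leqP m N.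
    rewrite (coef_expM_exp_ge _ inv) ?(leq_trans lemN) // mul1r subSn //.
    by rewrite (coef_geometric_exp _ inv) // addnBAC.
  rewrite (coef_expM_exp _ inv) // mul1r coef_exp_1DZX.
  rewrite !bin_small ?mulr0 //; first by rewrite ltn_subLR; lia.
  by lia.
have sign : (-1) ^+ (k - m) * (-1) ^+ k.+1 = - (-1) ^+ m :> R.
  rewrite -exprD; have -> : (k - m + k.+1 = (m + (k - m) * 2).+1)%N by lia.
  by rewrite exprS exprD [(_ * 2)%N]mulnC exprM sqrrN !expr1n mulr1 mulN1r.
rewrite subSn // !subn1 /= -[q - 1]opprB [(- (1 - q)) ^+ _]exprNn.
rewrite [(- q) ^+ _]exprNn [q ^+ k.+1]exprSr -[LHS]mulr_natr.
rewrite -[(-1) ^+ m]opprK -sign.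
move: (_ ^+ k.+1) (_ ^+ (k - m)) (_ ^+ (k - m)) (_%:R) (_%:R) => x y z u v.
by ring.
Qed.

(** The outer variable is w and the inner ['X] is q; the two binomials come from the two factors,
    one of them after the symmetry of binomial coefficients. *)
Lemma narayana_coef (n : nat) : (0 < n)%N ->
  narayana n =
  (((1 + 'X) * (1 + 'X *: 'X) : {poly {poly rat}}) ^+ n)`_n.-1 / n%:R.
Proof.
case: n => // n _; rewrite /narayana /= exprMn coefMr mulr_suml.
rewrite big_add1 /= big_mkord; apply: eq_bigr => j _.
rewrite subn1 /= coef_exp_1DZX coef_exp_1DX.
have -> : 'C(n.+1, n - j) = 'C(n.+1, j.+1) by rewrite -subSS bin_sub.
have -> : n.+1%:R^-1 = (n.+1%:R^-1)%:P :> {poly rat}.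
  by rewrite -[n.+1%:R in LHS]polyC_natr polyCV.
rewrite -mul_polyC !polyCM !polyC_natr.
by ring.
Qed.

Lemma natr_unit_poly_rat (n : nat) : n.+1%:R \is a @GRing.unit {poly rat}.
Proof. by rewrite -polyC_natr rmorph_unit // unitfE Num.Theory.pnatr_eq0. Qed.

Theorem theorem3 (n : nat) (hn : (1 <= n)%N) :
  narayana n =
    (1 - 'X) ^+ (n - 1)
    + 'X * \sum_(1 <= k < n)
             (narayana (n - k) *
              \sum_(0 <= m < k)
                 ((-1) ^+ m * 'C(k - 1, m)%:R * 'C(n - m, k)%:R
                  * (1 - 'X) ^+ (k - m - 1))).
Proof.
set P := fun N k : nat => \sum_(0 <= m < k) ((-1) ^+ m * 'C(k - 1, m)%:R
  * 'C(N + k - m, k)%:R * (1 - 'X) ^+ (k - m - 1)) : {poly rat}.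
have [E [r invE]] := geometric_inverse n.+1 ('X : {poly rat}).
have [D [s invD1]] := geometric_inverse n.+1 (1 : {poly rat}).
have invD := invD1; rewrite scale1r in invD.
have inv : (1 + 'X) * (1 + 'X *: 'X) * (D * E)
    = 1 + 'X^(n.+1) * (s + r + 'X^(n.+1) * (s * r)) :> {poly {poly rat}}.
  by rewrite mulrACA invE invD; ring.
pose f := (1 + 'X) ^+ n.-1 * E : {poly {poly rat}}.
(* Here [k] is the N of the overview. For [k < n], cancelling [D ^+ k] leaves [1 + 'X] to the power
   [(n - k).-1], as [coef_exp_geometric] requires; for [k = n] only a constant coefficient is
   read. *)
have coef_f k : (0 < k <= n)%N -> (f * ('X * (D * E)) ^+ k)`_n =
    if k == n then 1 else - 'X * P k (n - k)%N.
  case/andP=> k_gt0 lekn.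
  have -> : f * ('X * (D * E)) ^+ k
      = 'X^k * (E ^+ k.+1 * ((1 + 'X) ^+ n.-1 * D ^+ k)).
    by rewrite /f !exprMn exprS; ring.
  rewrite coefXnM ltnNge lekn /=; have [->|neq_kn] := eqVneq k n.
    rewrite subnn (coef_expM_exp_ge _ invD) ?leq_pred //.
    have -> : (n - n.-1 = 1)%N by lia.
    rewrite coef0M (coef_geometric_exp _ invE) // (coef_geometric_exp _ invD1) //.
    by rewrite !bin0 !expr0 !mulr1.
  rewrite (coef_expM_exp _ invD) ?ltnS ?leq_subr //; last by lia.
  rewrite mulrC; have -> : (n.-1 - k = (n - k).-1)%N by lia.
  by rewrite (coef_exp_geometric _ _ invE) ?polyX_eq0 //; lia.
have := fun i => Lagrange_inversion (i := i) natr_unit_poly_rat inv.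
set S := \sum_(1 <= k < _) _ => coef_S.
(* Only coefficients of [S] up to index [n] enter, so [S] may be replaced by ['X]; the binomial
   theorem then evaluates coefficient [n.-1] of [f]. *)
have : (f * S)`_n = (1 - 'X) ^+ (n - 1).
  rewrite coefM (eq_bigr (fun j : 'I_n.+1 => f`_j * 'X`_(n - j))); last first.
    by move=> j _; rewrite coef_S ?leq_subr.
  rewrite -coefM coefMX gtn_eqF // coefMr exprBn subn1.
  apply: eq_bigr => j _; rewrite coef_exp_1DX bin_sub -1?ltnS //.
  rewrite -[E]expr1 (coef_geometric_exp _ invE) ?binn //.
    by rewrite expr1n !mulr1 -exprNn mulr_natl.
  by rewrite (leq_trans (ltn_ord j)) // prednK // ltnW.
rewrite /S [f * _]mulr_sumr coef_sum big_nat_recr //=.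
under eq_big_nat => k /andP[k_gt0 ltkn] do
  rewrite -scalerAr coefZ -narayana_coef // coef_f ?k_gt0 1?ltnW // ltn_eqF //.
rewrite -scalerAr coefZ -narayana_coef // coef_f ?hn ?leqnn // eqxx mulr1.
(* Reversal exchanges [k] and [n - k]; the two sums then cancel term by term. *)
rewrite big_nat_rev /= => <-.
rewrite addrAC mulr_sumr -big_split /= big_nat big1 ?add0r // => k /andP[_ ltkn].
rewrite add1n subSS subKn ?(ltnW ltkn) // /P subnK ?(ltnW ltkn) //.
by rewrite mulrCA mulNr addNr.
Qed.
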